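(* Let $\mathcal{H}$ be a separable Hilbert space (of finite or infinite dimension) over $\mathbb{F}=\mathbb{R}$ or $\mathbb{C}$. Let $1\le p<\infty$ and let $q$ satisfy $1/p+1/q=1$ (with $q=\infty$ if $p=1$). Let $n\ge1$, let $\mathbf{A}_1,\dots,\mathbf{A}_n\in\mathcal{S}_p$ be self-adjoint and $\beta_1,\dots,\beta_n\in\mathbb{F}$, and let $$\mathcal{C}=\{\mathbf{P}\in\mathcal{P}_q : \operatorname{Tr}\mathbf{P}\mathbf{A}_j=\beta_j\text{ for }j=1,\dots,n\}.$$ If $\mathbf{P}$ is an extreme point of $\mathcal{C}$, then $n\ge\tfrac12(\operatorname{rank}\mathbf{P})(1+\operatorname{rank}\mathbf{P})$ when $\mathbb{F}=\mathbb{R}$, and $n\ge(\operatorname{rank}\mathbf{P})^2$ when $\mathbb{F}=\mathbb{C}$ (in particular $\operatorname{rank}\mathbf{P}$ is finite).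
   Context: For $1\le p<\infty$, $\mathcal{S}_p$ is the Schatten class (trace ideal) of compact operators $\mathbf{A}$ on $\mathcal{H}$ with $\operatorname{Tr}|\mathbf{A}|^p<\infty$, where $|\mathbf{A}|=(\mathbf{A}^*\mathbf{A})^{1/2}$; $\mathcal{S}_\infty$ is the space of compact operators. $\mathcal{P}$ is the set of positive operators (self-adjoint with $\langle x,\mathbf{P}x\rangle\ge0$ for all $x$), and $\mathcal{P}_q=\mathcal{P}\cap\mathcal{S}_q$. A point of a convex set $\mathcal{C}$ is extreme if it cannot be written as $\alpha p_1+(1-\alpha)p_2$ with $\alpha\in(0,1)$ and distinct $p_1,p_2\in\mathcal{C}$. *)

(* Defs.v *)
From HB Require Import structures.
From mathcomp Require Import all_boot all_order all_algebra.
From mathcomp Require Import complex.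
From mathcomp Require Import all_classical all_reals all_analysis.

Set Implicit Arguments.
Unset Strict Implicit.
Unset Printing Implicit Defensive.

Import Order.TTheory GRing.Theory Num.Theory.
Import numFieldNormedType.Exports.

Local Open Scope classical_set_scope.
Local Open Scope ring_scope.

Inductive scalar_kind := RealScalars | ComplexScalars.

Definition scalars (R : realType) (k : scalar_kind) : numFieldType :=
  match k with
  | RealScalars => R
  | ComplexScalars => R[i]
  end.

Definition scalar_conj (R : realType) (k : scalar_kind) :
    scalars R k -> scalars R k :=
  match k with
  | RealScalars => idfun
  | ComplexScalars => conjc
  end.

Definition scalar_of_real (R : realType) (k : scalar_kind) :
    R -> scalars R k :=
  match k with
  | RealScalars => idfun
  | ComplexScalars => real_complex R
  end.

Definition separable (T : topologicalType) :=
  exists2 S : set T, countable S & dense S.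

(* In R[i] the order implies that the difference is real, so that
   [0 < a < 1] forces [a] to be real also over complex scalars. *)
Definition extreme_point (K : numFieldType) (V : lmodType K) (C : set V)
    (x : V) :=
  C x /\ forall (a : K) (y z : V), 0 < a < 1 -> C y -> C z ->
    x = a *: y + (1 - a) *: z -> y = z.

Definition has_rank (K : numFieldType) (V : lmodType K) (T : V -> V) (r : nat) :=
  exists b : 'I_r -> V,
    [/\ forall i, range T (b i),
        forall c : 'I_r -> K,
          \sum_(i < r) c i *: b i = 0 -> forall i, c i = 0
      & forall x, exists c : 'I_r -> K, T x = \sum_(i < r) c i *: b i].

Section operators.
Context {R : realType} {K : numFieldType} (toK : R -> K) {theta : K -> K}.
Context {H : completeNormedModType K} (dot : {dot H for theta}).
Implicit Types (T B P : H -> H) (D : set nat) (e : nat -> H).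

(* [dot] is linear in its first argument and [theta]-linear in the second.
   Completeness of H is part of [completeNormedModType]. *)
Definition hilbert_norm := forall x, `|x| ^+ 2 = dot x x.

Definition bounded_operator T := linear T /\ continuous T.

Definition adjoint T T' := forall x y, dot (T x) y = dot x (T' y).

Definition self_adjoint T := bounded_operator T /\ adjoint T T.

Definition positive_operator P :=
  self_adjoint P /\ forall x, 0 <= dot (P x) x.

Definition compact_operator T :=
  bounded_operator T /\ precompact (T @` [set x | `|x| <= 1]).

(* The index set D accommodates finite as well as countably infinite bases. *)
Definition orthonormal_basis D e :=
  (forall i j, D i -> D j -> dot (e i) (e j) = (i == j)%:R) /\
  (forall x, (forall i, D i -> dot x (e i) = 0) -> x = 0).

(* The trace exists only if its defining series has the same sum in every
   orthonormal basis; a separable H has such a basis, so t is unique. *)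
Definition has_trace T (t : K) := forall D e, orthonormal_basis D e ->
  \sum_(0 <= i < m | i \in D) dot (T (e i)) (e i) @[m --> \oo] --> t.

(* B = |T| *)
Definition absolute_value T B :=
  positive_operator B /\ exists2 T', adjoint T T' & B \o B = T' \o T.

(* C = B ^ p, by functional calculus along an eigenbasis of B. *)
Definition operator_power (p : R) B (C : H -> H) :=
  bounded_operator C /\
  exists D e (lambda : nat -> R), orthonormal_basis D e /\
    forall i, D i -> [/\ 0 <= lambda i,
      B (e i) = toK (lambda i) *: e i
    & C (e i) = toK (lambda i `^ p) *: e i].

Definition schatten (p : \bar R) : set (H -> H) := [set T |
  compact_operator T /\
  match p with
  | p%:E => exists B C t,
      [/\ absolute_value T B, operator_power p B C & has_trace C t]
  | +oo => True
  | -oo => False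
  end%E].

Definition positive_schatten (q : \bar R) : set (H -> H) :=
  [set P | positive_operator P /\ schatten q P].

End operators.

(* Main.v *)
Require Import Defs.
From HB Require Import structures.
From mathcomp Require Import all_boot all_order all_algebra.
From mathcomp Require Import complex.
From mathcomp Require Import all_classical all_reals all_analysis.
From mathcomp Require Import zify ring lra.

Set Implicit Arguments.
Unset Strict Implicit.
Unset Printing Implicit Defensive.

Import Order.TTheory GRing.Theory Num.Theory.
Import numFieldNormedType.Exports.

Local Open Scope classical_set_scope.
Local Open Scope ring_scope.

(** Let v_1, ..., v_r be linearly independent vectors in the range of P, say
    v_i = P u_i, and for a Hermitian matrix M put
    D_M x = \sum_(i, j) M_ij <x, v_j> v_i.  By Cauchy-Schwarz for the
    semi-inner product <P x, y>, |<x, v_i>|^2 <= <P u_i, u_i> <P x, x>, so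
    |<D_M x, x>| is at most a constant times <P x, x>, and P + D_M and P - D_M
    are positive after scaling M.  If Tr (D_M A_j) = 0 for all j, then P is the
    midpoint of P + D_M and P - D_M and extremality forces M = 0.  Hence the n
    real-linear functionals M |-> Tr (D_M A_j) separate the Hermitian matrices,
    a real space of dimension r(r+1)/2 or r^2.

    For q = oo membership in S_q is compactness, which survives a perturbation
    of finite rank.  For q < oo the v_i are taken among the eigenvectors of P:
    the perturbation then only affects a finite block of the eigenbasis, and
    this block is diagonalized again by the spectral theorem for matrices. *)

(** * Scalars and inner products *)

(** A precompact set is one contained in a closed compact set; the Hausdorff hypothesis makes the
    compact image closed. *)
Lemma precompact_sub_image (T U : topologicalType) (f : T -> U) (B : set T)
    (A : set U) : hausdorff_space U -> continuous f -> compact B ->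
  A `<=` f @` B -> precompact A.
Proof.
move=> hU cf cB AfB; exists (f @` B) => //.
have cfB : compact (f @` B).
  by apply: continuous_compact => //; exact: continuous_subspaceT.
by split=> //; exact: compact_closed.
Qed.

Lemma real_complex_continuous (R : realType) :
  continuous (real_complex R : R -> (R[i] : numFieldType)).
Proof.
move=> x; apply/cvgrPdist_lt => -[e e']; rewrite ltcE/= => /andP[/eqP -> e0].
near=> y; rewrite -rmorphB normc_def/= expr0n/= addr0 sqrtr_sqr ltcR.
near: y.
have : id @ x --> x by exact: cvg_id.
by move=> /cvgrPdist_lt; apply.
Unshelve. all: by end_near. Qed.

Section scalars.
Context (R : realType) (k : scalar_kind).
Local Notation K := (scalars R k).
Local Notation theta := (@scalar_conj R k).

Lemma scalar_conj_zmod_morphism : zmod_morphism theta.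
Proof. by case: k => // x y /=; rewrite rmorphB. Qed.

Lemma scalar_conj_monoid_morphism : monoid_morphism theta.
Proof.
rewrite /monoid_morphism; case: k => /=; first by split.
by split=> [|x y]; rewrite ?rmorph1 ?rmorphM.
Qed.

HB.instance Definition _ :=
  GRing.isZmodMorphism.Build K K theta scalar_conj_zmod_morphism.
HB.instance Definition _ :=
  GRing.isMonoidMorphism.Build K K theta scalar_conj_monoid_morphism.

Lemma scalar_conjK : involutive theta.
Proof. by case: k => // x /=; rewrite conjcK. Qed.

Lemma scalar_sqr_norm (x : K) : `|x| ^+ 2 = x * theta x.
Proof.
case: k x => [x|x] /=; first by rewrite real_normK ?num_real.
by rewrite normCK.
Qed.

Lemma scalar_norm_conj (x : K) : `|theta x| = `|x|.
Proof.
apply/eqP; rewrite -(eqrXn2 (n := 2)) // !scalar_sqr_norm scalar_conjK.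
by rewrite mulrC.
Qed.

Lemma scalar_realE (x : K) : (x \is Num.real) = (theta x == x).
Proof.
case: k x => [x|x] /=; first by rewrite num_real eqxx.
by rewrite CrealE.
Qed.

Lemma scalar_ge0_real (x : K) : 0 <= x ->
  exists2 a : R, 0 <= a & x = @scalar_of_real R k a.
Proof.
case: k x => [x|[a b]] /=; first by exists x.
rewrite lecE /= => /andP[/eqP -> a0]; by exists a.
Qed.

Lemma scalar_of_real_ge0 (a : R) : 0 <= a -> 0 <= @scalar_of_real R k a.
Proof. by case: k => //=; rewrite ler0c. Qed.

(** The conclusion is a negated inequality because over the complex scalars [c] may be incomparable
    with every multiple of [e]. *)
Lemma scalar_archi (e c : K) : 0 < e -> exists N : nat, ~~ (N%:R * e <= c).
Proof.
have archi (x y : R) : 0 < x -> exists N : nat, y < N%:R * x.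
  move=> x0; exists (Num.bound `|y / x|); rewrite -ltr_pdivrMr //.
  exact: le_lt_trans (ler_norm _) (archi_boundP (normr_ge0 _)).
case: k e c => [e c e0|[e e'] [c c']] /=.
  by have [N cN] := archi e c e0; exists N; rewrite -ltNge.
rewrite ltcE/= => /andP[/eqP -> e0].
have [N cN] := archi e c e0; exists N.
rewrite -(rmorph_nat (real_complex R)) lecE/= negb_and; apply/orP; right.
by rewrite mulr0 subr0 -ltNge.
Qed.

Lemma scalar_ball_precompact (c : K) : precompact [set x : K | `|x| <= c].
Proof.
case: k c => [c|[c c']].
  have B : precompact [set x : R | `|x| <= c].
    apply: (@precompact_sub_image R R id `[-c, c]) => //.
    + by move=> x; exact: cvg_id.
    + exact: segment_compact.
    + by move=> x /= xc; exists x => //=; rewrite in_itv/= -ler_norml.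
  exact: B.
(* The disc lies in the image of the square with sides [[-c, c]] under (s, t) |-> s + i t. *)
pose f (x : R * R) : (R[i] : numFieldType) := x.1%:C%C + 'i * x.2%:C%C.
apply: (@precompact_sub_image _ _ f (`[-c, c] `*` `[-c, c])).
- exact: norm_hausdorff.
- move=> x; apply: cvgD.
    apply: (@cvg_comp _ _ _ fst (real_complex R)); first exact: cvg_fst.
    exact: real_complex_continuous.
  apply: cvgMr.
  apply: (@cvg_comp _ _ _ snd (real_complex R)); first exact: cvg_snd.
  exact: real_complex_continuous.
- by apply: compact_setX; exact: segment_compact.
- move=> [a b] /=; rewrite normc_def lecE/= => /andP[_ abc].
  have [sa sb] : `|a| <= c /\ `|b| <= c.
    by split; apply: le_trans abc; rewrite -sqrtr_sqr ler_wsqrtr //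
      ?lerDl ?lerDr sqr_ge0.
  exists (a, b); first by rewrite /= !in_itv/= -!ler_norml.
  by rewrite [RHS]complexE.
Qed.

Section dot.
Context (H : completeNormedModType K) (dot : {dot H for theta}).

Lemma dotC x y : dot x y = theta (dot y x).
Proof.
have := @hermitian_subproof _ _ _ _ dot x y.
by rewrite expr0 mul1r.
Qed.

Lemma dotDl x y z : dot (x + y) z = dot x z + dot y z.
Proof. exact: linearDl. Qed.
Lemma dotDr x y z : dot z (x + y) = dot z x + dot z y.
Proof. exact: linearDr. Qed.
Lemma dotZl a x z : dot (a *: x) z = a * dot x z.
Proof. exact: linearZl_LR. Qed.
Lemma dotZr a x z : dot z (a *: x) = theta a * dot z x.
Proof. exact: linearZr_LR. Qed.
Lemma dotNl x z : dot (- x) z = - dot x z.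
Proof. exact: linearNl. Qed.
Lemma dotNr x z : dot z (- x) = - dot z x.
Proof. exact: linearNr. Qed.
Lemma dot0l z : dot 0 z = 0.
Proof. exact: linear0l. Qed.
Lemma dot0r z : dot z 0 = 0.
Proof. exact: linear0r. Qed.
Lemma dot_suml I (r : seq I) (Q : pred I) F z :
  dot (\sum_(i <- r | Q i) F i) z = \sum_(i <- r | Q i) dot (F i) z.
Proof. exact: (big_morph (dot^~ z) (fun x y => dotDl x y z) (dot0l z)). Qed.
Lemma dot_sumr I (r : seq I) (Q : pred I) F z :
  dot z (\sum_(i <- r | Q i) F i) = \sum_(i <- r | Q i) dot z (F i).
Proof. exact: (big_morph (dot z) (fun x y => dotDr x y z) (dot0r z)). Qed.
Lemma dot_ge0 x : 0 <= dot x x.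
Proof.
have [->|/(@neq0_dnorm_gt0 _ _ _ dot) /ltW//] := eqVneq x 0.
by rewrite dot0l.
Qed.
Lemma dot_eq0 x : (dot x x == 0) = (x == 0).
Proof.
apply/idP/idP => [|/eqP ->]; last by rewrite dot0l.
by apply: contraLR => /(@neq0_dnorm_gt0 _ _ _ dot); rewrite lt0r => /andP[].
Qed.
End dot.
End scalars.

(** * Cauchy-Schwarz and finite rank operators *)

(** The value of the quadratic expression in the proof of Cauchy-Schwarz at t = b / d, where [c]
    stands for the conjugate of [b]. *)
Lemma complete_square (F : fieldType) (a b c d : F) : d != 0 ->
  a - c / d * b - b / d * c + b / d * (c / d) * d = a - b * c / d.
Proof. by move=> d0; field. Qed.

Lemma lipschitz0_continuous (K : numFieldType) (V W : normedModType K)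
    (f : V -> W) (c : K) :
  (forall x y, `|f x - f y| <= c * `|x - y|) -> continuous f.
Proof.
move=> fc x; apply/cvgrPdist_lt => e e0.
have c0 : 0 < `|c| + 1 by rewrite ltr_wpDl.
have : id @ x --> x by exact: cvg_id.
move=> /cvgrPdist_lt /(_ (e / (`|c| + 1)))/= H.
near=> y.
have : `|x - y| < e / (`|c| + 1) by near: y; apply: H; rewrite divr_gt0.
rewrite ltr_pdivlMr // => h; apply: le_lt_trans (fc x y) (le_lt_trans _ h).
(* Nothing is assumed on the sign of [c]; the bound itself forces 0 <= c as soon as x and y
   differ. *)
have [xy0|xy0] := eqVneq (`|x - y|) 0; first by rewrite xy0 mulr0 mul0r.
have xy1 : 0 < `|x - y| by rewrite lt0r xy0/=.
have c1 : 0 <= c by rewrite -(pmulr_lge0 _ xy1); apply: le_trans (fc x y).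
by rewrite mulrC ler_wpM2l // ger0_norm // lerDl.
Unshelve. all: by end_near. Qed.

Section dot.
Context {R : realType} {k : scalar_kind}.
Local Notation K := (scalars R k).
Local Notation theta := (@scalar_conj R k).
Context {H : completeNormedModType K} (dot : {dot H for theta}).
Local Notation bounded_operator := (@bounded_operator K H).
Local Notation compact_operator := (@compact_operator K H).

Lemma form_CauchySchwarz (P : H -> H) : linear P -> adjoint dot P P ->
  (forall x, 0 <= dot (P x) x) -> forall x y,
  `|dot (P x) y| ^+ 2 <= dot (P x) x * dot (P y) y.
Proof.
move=> linP adjP P0 x y.
set a := dot (P x) x; set d := dot (P y) y; set b := dot (P x) y.
have a0 : 0 <= a by exact: P0.
have d0 : 0 <= d by exact: P0.
(* Positivity at x - t y; below t = b / d if d > 0, and t is a large multiple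
   of b if d = 0. *)
have ineq t : 0 <= a - theta t * b - t * theta b + t * theta t * d.
  have -> : a - theta t * b - t * theta b + t * theta t * d =
      dot (P (- t *: y + x)) (- t *: y + x).
    rewrite linP dotDl !dotDr !dotZl !dotZr -/a -/d -/b rmorphN/=.
    have -> : dot (P y) x = theta b by rewrite adjP dotC.
    by ring.
  exact: P0.
have [dE|dn0] := eqVneq d 0; last first.
  have dp : 0 < d by rewrite lt0r dn0.
  have td : theta d = d by apply/eqP; rewrite -scalar_realE ger0_real.
  have := ineq (b / d); rewrite rmorphM fmorphV/= td.
  rewrite (_ : a - _ - _ + _ = a - `|b| ^+ 2 / d); last first.
    by rewrite scalar_sqr_norm complete_square.
  by rewrite subr_ge0 ler_pdivrMr.
rewrite dE mulr0; have [->|b0] := eqVneq b 0; first by rewrite normr0 expr0n.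
have bp : 0 < `|b| ^+ 2 by rewrite exprn_gt0 // normr_gt0.
have tb : theta (`|b| ^+ 2) = `|b| ^+ 2.
  by apply/eqP; rewrite -scalar_realE ger0_real // ltW.
have ta : theta a = a by apply/eqP; rewrite -scalar_realE ger0_real.
(* The factor is chosen so that both cross terms equal a + 1, which leaves the negative value - a -
   2. *)
have := ineq ((a + 1) / (`|b| ^+ 2) * b).
rewrite !rmorphM fmorphV/= tb rmorphD rmorph1 /= ta dE mulr0 addr0.
rewrite -mulrA -[_ * b * theta b]mulrA [theta b * b]mulrC -scalar_sqr_norm.
rewrite mulfVK ?lt0r_neq0 // (_ : a - _ - _ = - a - 2); last by ring.
rewrite -opprD oppr_ge0 => h; have : 0 < a + 2 by rewrite ltr_wpDl.
by move=> /lt_le_trans /(_ h); rewrite ltxx.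
Qed.

Context (hilbertH : hilbert_norm dot).

Lemma CauchySchwarz x y : `|dot x y| <= `|x| * `|y|.
Proof.
have h : `|dot x y| ^+ 2 <= dot x x * dot y y.
  by apply: (@form_CauchySchwarz id) => // u; exact: dot_ge0.
by rewrite -(ler_pXn2r (n := 2)) ?nnegrE ?mulr_ge0 // exprMn !hilbertH.
Qed.

Lemma dotl_continuous y : continuous (dot^~ y : H -> K^o).
Proof.
apply: (@lipschitz0_continuous _ _ _ _ `|y|) => x x'.
by rewrite -dotNl -dotDl mulrC CauchySchwarz.
Qed.

Lemma bounded_operatorD (S T : H -> H) : bounded_operator S ->
  bounded_operator T -> bounded_operator (fun x => S x + T x).
Proof.
move=> [lS cS] [lT cT]; split=> [a x y|x].
  by rewrite lS lT scalerDr addrACA.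
by apply: cvgD; [exact: cS|exact: cT].
Qed.

Lemma compact_operatorD (S T : H -> H) : compact_operator S ->
  compact_operator T -> compact_operator (fun x => S x + T x).
Proof.
move=> [bS [A SA [cA clA]]] [bT [B TB [cB clB]]].
split; first exact: bounded_operatorD.
apply: (@precompact_sub_image _ _ (fun z : H * H => z.1 + z.2) (A `*` B)).
- exact: norm_hausdorff.
- exact: add_continuous.
- exact: compact_setX.
- move=> _ [x x1 <-]; exists (S x, T x) => //; split=> /=.
    by apply: SA; exists x.
  by apply: TB; exists x.
Qed.

Lemma compact_operator0 : compact_operator (fun=> 0).
Proof.
split; first by split=> [a x y|x]; [rewrite scaler0 addr0|exact: cvg_cst].
exists [set 0]; first by move=> _ [x _ <-].
split; first exact: compact_set1.
by apply: compact_closed; [exact: norm_hausdorff|exact: compact_set1].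
Qed.

(** By Cauchy-Schwarz the unit ball goes into the image of a scalar ball under t |-> t b, and scalar
    balls are precompact. *)
Lemma compact_operator_rank1 a b : compact_operator (fun x => dot x a *: b).
Proof.
split.
  split=> [t x y|]; first by rewrite dotDl dotZl scalerDl scalerA.
  apply: (@lipschitz0_continuous _ _ _ _ (`|a| * `|b|)) => x y.
  rewrite -scalerBl -dotNl -dotDl normrZ mulrAC ler_wpM2r // mulrC.
  exact: CauchySchwarz.
have [A aA [cA clA]] := scalar_ball_precompact `|a|.
apply: (@precompact_sub_image _ _ (fun t : K^o => t *: b) A).
- exact: norm_hausdorff.
- apply: (@lipschitz0_continuous _ K^o _ _ `|b|) => s t.
  by rewrite -scalerBl normrZ mulrC.
- exact: cA.
- move=> _ [x x1 <-]; exists (dot x a) => //; apply: aA => /=.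
  by apply: (le_trans (CauchySchwarz _ _)); rewrite ler_piMl.
Qed.

Definition finite_rank m (a b : 'I_m -> H) (x : H) := \sum_i dot x (a i) *: b i.

Lemma compact_finite_rank m (a b : 'I_m -> H) :
  compact_operator (finite_rank a b).
Proof.
rewrite /finite_rank; elim: (index_enum _) => [|i s IHs].
  rewrite (_ : (fun x => _) = fun=> 0); first exact: compact_operator0.
  by apply/funext => x; rewrite big_nil.
rewrite (_ : (fun x => _) =
    fun x => dot x (a i) *: b i + \sum_(j <- s) dot x (a j) *: b j).
  exact: compact_operatorD (compact_operator_rank1 _ _) IHs.
by apply/funext => x; rewrite big_cons.
Qed.

End dot.

(** * Parseval's identity and traces *)

Section trace.
Context {R : realType} {k : scalar_kind}.
Local Notation K := (scalars R k).
Local Notation theta := (@scalar_conj R k).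
Context {H : completeNormedModType K} (dot : {dot H for theta}).
Context (hilbertH : hilbert_norm dot).

(** Otherwise there would be infinitely many consecutive disjoint blocks of sum at least [e], and
    the partial sums would exceed every multiple of [e], against the Archimedean property. *)
Lemma scalar_bounded_sum_cauchy (u : nat -> K) (c : K) : (forall i, 0 <= u i) ->
  (forall m, \sum_(0 <= i < m) u i <= c) -> forall e, 0 < e ->
  exists N, forall m n, (N <= m)%N -> (m <= n)%N -> \sum_(m <= i < n) u i < e.
Proof.
move=> u0 uc e e0; apply: contrapT => notC.
have step N : exists n, (N <= n)%N /\ e <= \sum_(N <= i < n) u i.
  have /existsNP[m /existsNP[n]] := proj2 (forallNP _) notC N.
  move=> /not_implyP[Nm] /not_implyP[mn] /negP.
  have er : e \is Num.real by rewrite gtr0_real.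
  have sr : \sum_(m <= i < n) u i \is Num.real by rewrite ger0_real ?sumr_ge0.
  rewrite -real_leNgt // => lee.
  exists n; split; first exact: leq_trans mn.
  by rewrite (@big_cat_nat _ _ _ m) //= ler_wpDl // sumr_ge0.
have big N : exists n, N%:R * e <= \sum_(0 <= i < n) u i.
  elim: N => [|N [n IHn]]; first by exists 0; rewrite mul0r big_geq.
  have [p [np ep]] := step n; exists p.
  by rewrite (@big_cat_nat _ _ _ n) //= -addn1 natrD mulrDl mul1r lerD.
have [N /negP[]] := scalar_archi c e0; have [n hn] := big N.
exact: le_trans hn (uc n).
Qed.

Section basis.
Context (D : set nat) (e : nat -> H) (De : orthonormal_basis dot D e).

Let coef (x : H) (i : nat) : H := if i \in D then dot x (e i) *: e i else 0.

Let dot_coef x y i :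
  dot (coef x i) y = if i \in D then dot x (e i) * dot (e i) y else 0.
Proof. by rewrite /coef; case: ifP; rewrite ?dotZl ?dot0l. Qed.

Let dot_coef_e x i j : D j ->
  dot (coef x i) (e j) = if i == j then dot x (e j) else 0.
Proof.
move=> Dj; rewrite dot_coef; have [->|ij] := eqVneq i j.
  by rewrite mem_set // De.1 // eqxx mulr1.
by case: ifPn => // /set_mem Di; rewrite De.1 // (negbTE ij) mulr0.
Qed.

Let dot_sum_e x m n j : D j ->
  dot (\sum_(m <= i < n) coef x i) (e j) =
  if (m <= j < n)%N then dot x (e j) else 0.
Proof.
move=> Dj; rewrite dot_suml (eq_bigr _ (fun i _ => dot_coef_e x i Dj)).
by rewrite -big_mkcond /= big_nat1_eq.
Qed.

Let dot_sum_sum x m n :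
  dot (\sum_(m <= i < n) coef x i) (\sum_(m <= i < n) coef x i) =
  \sum_(m <= i < n) `|if i \in D then dot x (e i) else 0| ^+ 2.
Proof.
rewrite dot_sumr [LHS]big_nat_cond [RHS]big_nat_cond; apply: eq_bigr => i.
rewrite andbT => imn; rewrite {2}/coef; case: ifPn => [/set_mem Di|_]; last first.
  by rewrite dot0r normr0 expr0n.
by rewrite dotZr dot_sum_e // imn scalar_sqr_norm mulrC.
Qed.

(** Expand <x - s, x - s> >= 0 for the partial Fourier sum s: the numbers <s, x>, <x, s> and <s, s>
    all equal the left-hand side. *)
Lemma Bessel x m :
  \sum_(0 <= i < m) `|if i \in D then dot x (e i) else 0| ^+ 2 <= dot x x.
Proof.
set S := \sum_(0 <= i < m) _.
pose s := \sum_(0 <= i < m) coef x i.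
have sx : dot s x = S.
  rewrite dot_suml; apply: eq_bigr => i _; rewrite dot_coef.
  case: ifP => _; last by rewrite normr0 expr0n.
  by rewrite scalar_sqr_norm [dot (e i) x]dotC.
have xs : dot x s = S.
  rewrite dotC sx; apply/eqP; rewrite -scalar_realE ger0_real //.
  by rewrite sumr_ge0 // => i _; rewrite exprn_ge0.
have := dot_ge0 dot (x - s).
rewrite dotDl !dotDr !dotNl !dotNr xs sx dot_sum_sum -/S opprK.
by rewrite addNr addr0 subr_ge0.
Qed.

(** Bessel's inequality makes the series Cauchy, so it has a limit y by completeness. The
    coefficients of the partial sums are eventually those of x, so x - y is orthogonal to the whole
    basis and vanishes. *)
Lemma Fourier_cvg x : \sum_(0 <= i < m) coef x i @[m --> \oo] --> x.
Proof.
have /cvg_ex[y yP] : cvg (series (coef x) @ \oo).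
  apply/cauchy_cvgP/cauchy_seriesP => d d0.
  have [N NP] := scalar_bounded_sum_cauchy (u := fun i => _)
    (fun i => exprn_ge0 2 (normr_ge0 _)) (Bessel x) (exprn_gt0 2 d0).
  exists ([set n | (N <= n)%N], [set n | (N <= n)%N]) => /=.
    by split; exists N.
  move=> [m n] [/= Nm Nn]; have [mn|/ltnW nm] := leqP m n; last first.
    by rewrite big_geq // normr0.
  by rewrite -(ltr_pXn2r (n := 2)) ?nnegrE ?(ltW d0) // hilbertH dot_sum_sum NP.
suff xy : x = y by rewrite [X in _ --> X]xy; exact: yP.
apply/eqP; rewrite -subr_eq0; apply/eqP/De.2 => j Dj.
rewrite dotDl dotNl; apply/eqP; rewrite subr_eq0; apply/eqP.
have h : dot (series (coef x) n) (e j) @[n --> \oo] --> (dot y (e j) : K^o).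
  apply: (@cvg_comp _ _ _ (series (coef x)) (dot^~ (e j)) _ _ _ yP).
  exact: dotl_continuous.
symmetry.
apply: (@cvg_unique K^o _ (dot (series (coef x) n) (e j) @[n --> \oo])) => //.
apply: cvg_near_cst; near=> n; rewrite /= /series /= dot_sum_e //.
by rewrite leq0n /= ifT //; near: n; exists j.+1.
Unshelve. all: by end_near. Qed.

(** Apply the continuous functional <., y> to the Fourier series of x. *)
Lemma Parseval x y :
  \sum_(0 <= i < m | i \in D) dot x (e i) * dot (e i) y @[m --> \oo] -->
  (dot x y : K^o).
Proof.
have h : dot (series (coef x) m) y @[m --> \oo] --> (dot x y : K^o).
  have F : series (coef x) @ \oo --> x by exact: Fourier_cvg.
  have G : dot z y @[z --> x] --> (dot x y : K^o) by exact: dotl_continuous.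
  exact: (cvg_comp _ _ F G).
rewrite (_ : (fun m => _) = fun m => dot (series (coef x) m) y) //.
apply/funext => m; rewrite dot_suml big_mkcond; apply: eq_bigr => i _.
by rewrite dot_coef.
Qed.

End basis.

Lemma has_traceD S T s t : has_trace dot S s -> has_trace dot T t ->
  has_trace dot (fun x => S x + T x) (s + t).
Proof.
move=> hS hT D e De.
rewrite (_ : (fun m => _) = fun m =>
   \sum_(0 <= i < m | i \in D) dot (S (e i)) (e i) +
   \sum_(0 <= i < m | i \in D) dot (T (e i)) (e i)); last first.
  by apply/funext => m; rewrite -big_split; apply: eq_bigr => i _; rewrite dotDl.
exact: (@cvgD K K^o _ _ _ _ _ _ _ (hS D e De) (hT D e De)).
Qed.

(** After exchanging the two sums, each index i contributes the Parseval series of [b i] and [a i],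
    whose sum does not depend on the basis. *)
Lemma has_trace_finite_rank m (a b : 'I_m -> H) :
  has_trace dot (finite_rank dot a b) (\sum_i dot (b i) (a i)).
Proof.
move=> D e De.
rewrite (_ : (fun n => _) = fun n => \sum_i
   \sum_(0 <= j < n | j \in D) dot (b i) (e j) * dot (e j) (a i)); last first.
  apply/funext => n; rewrite exchange_big; apply: eq_bigr => j _.
  by rewrite dot_suml; apply: eq_bigr => i _; rewrite dotZl mulrC.
elim: (index_enum _) => [|i s IHs].
  by under eq_fun do rewrite big_nil; rewrite big_nil; exact: cvg_cst.
under eq_fun do rewrite big_cons; rewrite big_cons.
exact: (@cvgD K K^o _ _ _ _ _ _ _ (@Parseval _ _ De (b i) (a i)) IHs).
Qed.

End trace.

(** * Spectral theorem over real and complex scalars *)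

Lemma real_complex_conj (R : rcfType) (x : R) : (x%:C%C)^* = x%:C%C.
Proof. exact: conjc_real. Qed.

(** Over the complex numbers [G'] has an eigenvalue a with left eigenvector v, and z = v B is a
    nonzero left eigenvector of [G]. Computing z G z^* in two ways shows that a is its own
    conjugate; being real, it is already a root of the characteristic polynomial over [R]. *)
Lemma symmetric_restriction_eigenvalue (R : rcfType) (s m : nat) (G : 'M[R]_s)
    (B : 'M[R]_(m, s)) (G' : 'M[R]_m) : G^T = G -> (0 < m)%N -> row_free B ->
  B *m G = G' *m B -> exists a, eigenvalue G' a.
Proof.
move=> symG m0 freeB BG; pose f := real_complex R.
have [a /[dup] eva /eigenvalueP[v vG' v0]] :=
  eigenvalue_closed (map_mx f G') m0.
pose z := v *m map_mx f B.
have z0 : z != 0.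
  have fB : row_free (map_mx f B) by rewrite row_free_map.
  by apply: contra_neq v0 => z0; apply: (row_free_inj fB); rewrite mul0mx.
have zG : z *m map_mx f G = a *: z.
  by rewrite /z -mulmxA -map_mxM BG map_mxM mulmxA vG' scalemxAl.
pose zc := (map_mx Num.conj z)^T.
pose N := (z *m zc) 0 0.
have N0 : N != 0.
  have Fge i : true -> 0 <= z 0 i * zc i 0 by rewrite !mxE -normCK exprn_ge0.
  apply: contra_neq z0; rewrite /N mxE => /(psumr_eq0P Fge) zi0.
  apply/rowP => i; have := zi0 i isT.
  by rewrite !mxE -normCK => /eqP; rewrite sqrf_eq0 normr_eq0 => /eqP.
have zcG : map_mx f G *m zc = a^* *: zc.
  apply: trmx_inj; rewrite /zc trmx_mul linearZ/= trmxK map_trmx symG.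
  rewrite -map_mxZ -zG [RHS]map_mxM; congr (_ *m _).
  by apply/matrixP => i j; rewrite !mxE; symmetry; exact: real_complex_conj.
have aN : a * N = a^* * N.
  have := congr1 (fun A : 'M[R[i]]_1 => A 0 0) (mulmxA z (map_mx f G) zc).
  by rewrite zcG zG -scalemxAr -scalemxAl mxE => h; rewrite /N h [RHS]mxE.
have : a = a^* by apply: (mulIf N0).
case: a eva {vG' zG zcG aN} => b c eva [] /eqP; rewrite -addr_eq0 => c0.
have {}c0 : c = 0 by apply/eqP; move: c0; rewrite -mulr2n mulrn_eq0.
exists b; move: eva; rewrite c0 !eigenvalue_root_char -map_char_poly.
by rewrite -(fmorph_root f).
Qed.

Section spectral.
Context (R : realType) (k : scalar_kind).
Local Notation K := (scalars R k).
Local Notation theta := (@scalar_conj R k).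
Local Notation adjmx A := ((map_mx theta A)^T).

Lemma adjmxM m n p (A : 'M[K]_(m, n)) (B : 'M[K]_(n, p)) :
  adjmx (A *m B) = adjmx B *m adjmx A.
Proof. by rewrite map_mxM trmx_mul. Qed.

Lemma adjmxK m n (A : 'M[K]_(m, n)) : adjmx (adjmx A) = A.
Proof. by apply/matrixP => i j; rewrite !mxE scalar_conjK. Qed.

(* B describes an invariant subspace of G, and G' the restriction of G to it;
   over the reals a complex eigenvalue of G' is one of G, hence is real. *)
Lemma hermitian_restriction_eigenvalue (s m : nat) (G : 'M[K]_s)
    (B : 'M[K]_(m, s)) (G' : 'M[K]_m) :
  adjmx G = G -> (0 < m)%N -> row_free B ->
  B *m G = G' *m B -> exists a, eigenvalue G' a.
Proof.
case: k G B G' => G B G' GH m0 freeB BG; last exact: eigenvalue_closed.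
have symG : G^T = G.
  by rewrite -[RHS]GH; congr (_^T); apply/matrixP => i j; rewrite mxE.
exact: (@symmetric_restriction_eigenvalue R s m G B G' symG m0 freeB BG).
Qed.

Lemma scalar_sqrt (t : K) : 0 < t -> exists2 c : K, 0 < c & c ^+ 2 = t.
Proof.
move=> t0; have [a a0 ta] := scalar_ge0_real (ltW t0).
have c2 : @scalar_of_real R k (Num.sqrt a) ^+ 2 = t.
  rewrite ta; case: k => /=; first by rewrite sqr_sqrtr.
  by rewrite -rmorphXn sqr_sqrtr.
exists (@scalar_of_real R k (Num.sqrt a)) => //.
rewrite lt0r scalar_of_real_ge0 ?sqrtr_ge0 // andbT.
by apply: contraTneq t0 => c0; rewrite -c2 c0 expr0n ltxx.
Qed.

Lemma mulmx_adj_gt0 n (u : 'rV[K]_n) : u != 0 -> 0 < (u *m adjmx u) 0 0.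
Proof.
have Fge i : true -> 0 <= u 0 i * (adjmx u) i 0.
  by rewrite !mxE -scalar_sqr_norm exprn_ge0.
rewrite mxE lt0r sumr_ge0 ?andbT => [u0|i _]; last exact: Fge.
apply: contra_neq u0 => /(psumr_eq0P Fge) ui0.
apply/rowP => i; have := ui0 i isT.
by rewrite !mxE -scalar_sqr_norm => /eqP; rewrite sqrf_eq0 normr_eq0 => /eqP.
Qed.

(** The rows of [U] are orthonormal left eigenvectors, added one at a time: as long as m < s, the
    orthogonal complement of their span is nonzero and invariant under [G], hence contains a further
    eigenvector. *)
Theorem hermitian_spectral s (G : 'M[K]_s) : adjmx G = G ->
  exists (U : 'M[K]_s) (mu : 'rV[K]_s),
    U *m adjmx U = 1%:M /\ U *m G = diag_mx mu *m U.
Proof.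
move=> GH; suff partial m : (m <= s)%N ->
    exists (U : 'M[K]_(m, s)) (mu : 'rV[K]_m),
    U *m adjmx U = 1%:M /\ U *m G = diag_mx mu *m U by exact: partial.
elim: m => [|m IHm] ms.
  by exists 0, 0; split; apply/matrixP => -[].
have [U [mu [UU UG]]] := IHm (ltnW ms).
(* The rows of [B] form a basis of the orthogonal complement of the rows of [U]. *)
pose B := row_base (kermx (adjmx U)).
have BU : B *m adjmx U = 0.
  by apply/sub_kermxP; rewrite eq_row_base.
have GU : G *m adjmx U = adjmx U *m adjmx (diag_mx mu).
  by rewrite -adjmxM -UG adjmxM GH.
have /submxP[G' BG] : (B *m G <= B)%MS.
  by rewrite eq_row_base; apply/sub_kermxP; rewrite -mulmxA GU mulmxA BU mul0mx.
have r0 : (0 < \rank (kermx (adjmx U)))%N.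
  by rewrite mxrank_ker subn_gt0 (leq_ltn_trans (rank_leq_col _)).
have [a /eigenvalueP[w wG' w0]] :=
  hermitian_restriction_eigenvalue GH r0 (row_base_free _) BG.
have u0 : w *m B != 0.
  apply: contra_neq w0 => z0; apply: (row_free_inj (row_base_free _)).
  by rewrite z0 mul0mx.
have [c c0 c2] := scalar_sqrt (mulmx_adj_gt0 u0).
pose u := c^-1 *: (w *m B).
have cc : theta c = c by apply/eqP; rewrite -scalar_realE gtr0_real.
have uu : u *m adjmx u = 1%:M.
  apply/matrixP => i j; rewrite !ord1 /u map_mxZ linearZ/= -scalemxAl -scalemxAr.
  rewrite 2!mxE -c2 fmorphV/= cc mxE eqxx.
  by rewrite expr2 mulKf ?lt0r_neq0 // mulVf // lt0r_neq0.
have uU : u *m adjmx U = 0 by rewrite -scalemxAl -mulmxA BU mulmx0 scaler0.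
have Uu : U *m adjmx u = 0.
  by rewrite -[U]adjmxK -adjmxM uU map_mx0 trmx0.
rewrite -[m.+1]/(1 + m)%N; exists (col_mx u U), (row_mx a%:M mu); split.
  rewrite map_col_mx tr_col_mx mul_col_row uu uU Uu UU.
  by rewrite -scalar_mx_block.
rewrite mul_col_mx UG diag_mx_row mul_block_col !mul0mx addr0 add0r.
congr col_mx; rewrite -scalemxAl -mulmxA BG mulmxA wG'.
rewrite -scalemxAl scalerA mulrC -scalerA.
by rewrite -/u (_ : diag_mx _ = a%:M) ?mul_scalar_mx //; apply/matrixP => i j;
   rewrite !ord1 !mxE.
Qed.
End spectral.

(** * Perturbations of an extreme point *)

Section perturbation.
Context {R : realType} {k : scalar_kind}.
Local Notation K := (scalars R k).
Local Notation theta := (@scalar_conj R k).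
Context {H : completeNormedModType K} (dot : {dot H for theta}).
Context (hilbertH : hilbert_norm dot).

Definition selfadjoint_mx m (M : 'M[K]_m) := forall i j, theta (M i j) = M j i.

(** This is D_M. The entries of M are conjugated because they sit in the second argument of [dot],
    which is conjugate-linear; in this shape the results on [finite_rank] apply. *)
Definition form_operator m (v : 'I_m -> H) (M : 'M[K]_m) : H -> H :=
  finite_rank dot (fun i => \sum_j theta (M i j) *: v j) v.

Lemma form_operatorE m (v : 'I_m -> H) M x :
  form_operator v M x = \sum_i (\sum_j M i j * dot x (v j)) *: v i.
Proof.
apply: eq_bigr => i _; congr (_ *: _); rewrite dot_sumr.
by apply: eq_bigr => j _; rewrite dotZr scalar_conjK.
Qed.

Lemma dot_form_operator m (v : 'I_m -> H) M x y :
  dot (form_operator v M x) y =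
  \sum_i \sum_j M i j * dot x (v j) * dot (v i) y.
Proof.
rewrite form_operatorE dot_suml; apply: eq_bigr => i _.
by rewrite dotZl mulr_suml.
Qed.

Lemma form_operatorZ m (v : 'I_m -> H) M s x :
  form_operator v (s *: M) x = s *: form_operator v M x.
Proof.
rewrite !form_operatorE scaler_sumr; apply: eq_bigr => i _.
rewrite scalerA mulr_sumr; congr (_ *: _); apply: eq_bigr => j _.
by rewrite mxE mulrA.
Qed.

Lemma form_operator_adjoint m (v : 'I_m -> H) M : selfadjoint_mx M ->
  adjoint dot (form_operator v M) (form_operator v M).
Proof.
move=> hM x y; rewrite [RHS]dotC !dot_form_operator rmorph_sum exchange_big /=.
apply: eq_bigr => i _; rewrite rmorph_sum /=; apply: eq_bigr => j _.
rewrite !rmorphM /= hM -!dotC; ring.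
Qed.

Lemma form_operator_self_adjoint m (v : 'I_m -> H) M : selfadjoint_mx M ->
  self_adjoint dot (form_operator v M).
Proof.
move=> hM; split; last exact: form_operator_adjoint.
exact: (compact_finite_rank hilbertH _ _).1.
Qed.

Lemma self_adjointD S T : self_adjoint dot S -> self_adjoint dot T ->
  self_adjoint dot (fun x => S x + T x).
Proof.
move=> [bS aS] [bT aT]; split; first exact: bounded_operatorD.
by move=> x y; rewrite dotDl dotDr aS aT.
Qed.

Lemma self_adjoint_real T x : self_adjoint dot T -> dot (T x) x \is Num.real.
Proof. by move=> [_ aT]; rewrite scalar_realE -dotC aT. Qed.

Lemma form_operator_bound (P : H -> H) m (u : 'I_m -> H) (M : 'M[K]_m) :
  positive_operator dot P ->
  exists2 c : K, 0 <= c & forall x,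
    `|dot (form_operator (P \o u) M x) x| <= c * dot (P x) x.
Proof.
move=> [[[linP _] aP] P0].
exists (\sum_i \sum_j `|M i j| * (dot (P (u j)) (u j) + dot (P (u i)) (u i))).
  by do 2 (apply: sumr_ge0 => ? _); rewrite mulr_ge0 // addr_ge0.
move=> x; rewrite dot_form_operator mulr_suml.
apply: le_trans (ler_norm_sum _ _ _) _; apply: ler_sum => i _.
rewrite mulr_suml; apply: le_trans (ler_norm_sum _ _ _) _; apply: ler_sum => j _.
rewrite -mulrA normrM -mulrA ler_wpM2l // normrM mulrDl.
have h l : `|dot x (P (u l))| ^+ 2 <= dot (P (u l)) (u l) * dot (P x) x.
  by rewrite -aP mulrC form_CauchySchwarz.
rewrite [dot (P (u i)) x]dotC scalar_norm_conj.
(* It remains to see that a b <= a^2 + b^2, which holds because the difference is (a - b)^2 + a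
   b. *)
apply: le_trans (lerD (h j) (h i)).
set a := `|_|; set b := `|_|.
have ar : a - b \is Num.real by rewrite rpredB // normr_real.
rewrite -subr_ge0 (_ : _ - _ = (a - b) ^+ 2 + a * b); last by ring.
by rewrite addr_ge0 ?real_exprn_even_ge0 //; apply: mulr_ge0; exact: normr_ge0.
Qed.

(** With [c] from [form_operator_bound], a factor of modulus 1 / (c + 1) makes the perturbation at
    most <P x, x>. Letting s be any real scalar of that modulus covers both signs. *)
Lemma positive_operator_perturbation (P : H -> H) m (u : 'I_m -> H)
    (M : 'M[K]_m) :
  positive_operator dot P -> selfadjoint_mx M ->
  exists2 e : K, 0 < e & forall s : K, `|s| = e -> s \is Num.real ->
    positive_operator dot (fun x => P x + form_operator (P \o u) (s *: M) x).
Proof.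
move=> posP hM; have [c c0 cP] := form_operator_bound u M posP.
have c1 : 0 < c + 1 by rewrite ltr_wpDl.
exists (c + 1)^-1; first by rewrite invr_gt0.
move=> s se sr.
have hsM : selfadjoint_mx (s *: M).
  move=> i j; rewrite !mxE rmorphM /= hM; congr (_ * _).
  by apply/eqP; rewrite -scalar_realE.
have [saP P0] := posP; have saD := form_operator_self_adjoint (P \o u) hsM.
split=> [|x]; first exact: self_adjointD.
rewrite dotDl -lerBlDr sub0r.
apply: le_trans (_ : `|dot (form_operator (P \o u) (s *: M) x) x| <= _); last first.
  rewrite form_operatorZ dotZl normrM se ler_pdivrMl //.
  by apply: le_trans (cP x) _; rewrite ler_wpM2r // lerDl.
rewrite -normrN; apply: real_ler_norm; rewrite rpredN.
exact: self_adjoint_real.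
Qed.

(** Independence is used twice. It first gives <x, w> = 0 for all x, where w is the combination of
    the [v j] with the conjugates of row i of [M] as coefficients; taking x = w gives w = 0, so that
    row vanishes. *)
Lemma form_operator_inj m (v : 'I_m -> H) (M : 'M[K]_m) :
  (forall c : 'I_m -> K, \sum_i c i *: v i = 0 -> forall i, c i = 0) ->
  (forall x, form_operator v M x = 0) -> M = 0.
Proof.
move=> freev D0.
have Mv i x : \sum_j M i j * dot x (v j) = 0.
  by move: (D0 x); rewrite form_operatorE => /freev /(_ i).
apply/matrixP => i j; rewrite mxE -[LHS]scalar_conjK -(rmorph0 theta).
congr theta; apply: (freev (fun j => theta (M i j))).
set w := \sum_j _; apply/eqP; rewrite -(dot_eq0 dot); apply/eqP.
rewrite -[RHS](Mv i w) {2}/w dot_sumr; apply: eq_bigr => l _.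
by rewrite dotZr scalar_conjK.
Qed.

(** Self-adjointness moves [T] onto the vectors [v j], which exhibits the composite as an operator
    of finite rank. *)
Lemma has_trace_form_operator_comp m (v : 'I_m -> H) (M : 'M[K]_m) T :
  self_adjoint dot T ->
  has_trace dot (form_operator v M \o T)
    (\sum_i \sum_j M i j * dot (v i) (T (v j))).
Proof.
move=> [[linT _] aT].
rewrite (_ : _ \o T =
    finite_rank dot (fun i => \sum_j theta (M i j) *: T (v j)) v); last first.
  apply/funext => x /=; rewrite form_operatorE; apply: eq_bigr => i _.
  congr (_ *: _); rewrite dot_sumr; apply: eq_bigr => j _.
  by rewrite dotZr scalar_conjK aT.
rewrite (_ : \sum_i _ = \sum_i dot (v i) (\sum_j theta (M i j) *: T (v j))).
  exact: has_trace_finite_rank.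
apply: eq_bigr => i _; rewrite dot_sumr; apply: eq_bigr => j _.
by rewrite dotZr scalar_conjK.
Qed.

(** Membership of the perturbations in S_q is taken as a hypothesis, so that one extremality
    argument serves both finite and infinite [q]. *)
Lemma extreme_point_trace_injective (q : \bar R) n (A : 'I_n -> H -> H)
    (beta : 'I_n -> K) (P : H -> H) m (u : 'I_m -> H) :
  (forall j, self_adjoint dot (A j)) ->
  extreme_point
    [set Q | positive_schatten (@scalar_of_real R k) dot q Q /\
             forall j, has_trace dot (Q \o A j) (beta j)] P ->
  (forall c : 'I_m -> K, \sum_i c i *: P (u i) = 0 -> forall i, c i = 0) ->
  (forall M, selfadjoint_mx M ->
     positive_operator dot (fun x => P x + form_operator (P \o u) M x) ->
     schatten (@scalar_of_real R k) dot q
       (fun x => P x + form_operator (P \o u) M x)) ->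
  forall M : 'M[K]_m, selfadjoint_mx M ->
  (forall j, \sum_i \sum_l M i l * dot (P (u i)) (A j (P (u l))) = 0) -> M = 0.
Proof.
move=> sA [[[posP _] trP] extP] freeP schP M hM M0.
have [e e0 eP] := positive_operator_perturbation u posP hM.
pose Q s x := P x + form_operator (P \o u) (s *: M) x.
have CQ s : `|s| = e -> s \is Num.real ->
    positive_schatten (@scalar_of_real R k) dot q (Q s) /\
    forall j, has_trace dot (Q s \o A j) (beta j).
  move=> se sr; have hsM : selfadjoint_mx (s *: M).
    move=> i j; rewrite !mxE rmorphM /= hM; congr (_ * _).
    by apply/eqP; rewrite -scalar_realE.
  split; first by split; [exact: eP|apply: schP => //; exact: eP].
  move=> j; rewrite -[beta j]addr0; apply: (has_traceD (trP j)).
  rewrite (_ : 0 = \sum_i \sum_l (s *: M) i l * dot (P (u i)) (A j (P (u l)))).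
    exact: has_trace_form_operator_comp.
  rewrite -[LHS](mulr0 s) -[X in s * X](M0 j) mulr_sumr; apply: eq_bigr => i _.
  by rewrite mulr_sumr; apply: eq_bigr => l _; rewrite mxE mulrA.
have half : 0 < (2^-1 : K) < 1 by rewrite invr_gt0 ltr0n invf_lt1 ?ltr1n.
have QQ : Q e = Q (- e).
  apply: (extP 2^-1) => //.
  - by apply: CQ; rewrite ?gtr0_norm ?gtr0_real.
  - by apply: CQ; rewrite ?normrN ?rpredN ?gtr0_norm ?gtr0_real.
  - apply/funext => x; rewrite /Q !fctE !form_operatorZ scaleNr.
    rewrite (_ : 1 - 2^-1 = 2^-1 :> K); last first.
      by rewrite [X in X - _]splitr div1r addrK.
    rewrite -scalerDr addrACA subrr addr0 -mulr2n -[P x *+ 2]scaler_nat.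
    by rewrite scalerA mulVf ?scale1r.
apply: (form_operator_inj freeP) => x.
have := congr1 (@^~ x) QQ; rewrite /Q !form_operatorZ scaleNr => /addrI /eqP.
rewrite -addr_eq0 -mulr2n -scaler_nat scalerA scaler_eq0 mulf_eq0 pnatr_eq0 /=.
by rewrite (gt_eqF e0) => /eqP.
Qed.

End perturbation.

(** * Dimension of the space of Hermitian matrices *)

(** There are fewer equations than unknowns. General finite index types allow matrix positions as
    unknowns and a disjoint sum as index set of the equations. *)
Lemma exists_kernel (F : fieldType) (I J : finType) (a : J -> I -> F) :
  (#|J| < #|I|)%N ->
  exists2 c : I -> F, exists i, c i != 0 & forall j, \sum_i c i * a j i = 0.
Proof.
move=> JI.
pose A : 'M[F]_(#|I|, #|J|) := \matrix_(i, j) a (enum_val j) (enum_val i).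
have : kermx A != 0.
  rewrite kermx_eq0 /row_free; apply: contraTneq JI => rA.
  by rewrite -leqNgt -rA rank_leq_col.
case/rowV0Pn => w /sub_kermxP wA w0.
exists (fun i => w 0 (enum_rank i)).
  have /rV0Pn[i wi] := w0; exists (enum_val i); by rewrite enum_valK.
move=> j; have := congr1 (fun B : 'rV[F]_ _ => B 0 (enum_rank j)) wA.
rewrite !mxE => wj; rewrite -[RHS]wj (reindex (@enum_val I xpredT)) /=; last first.
  by exists enum_rank => i _; rewrite ?enum_valK ?enum_rankK.
by apply: eq_bigr => i _; rewrite mxE enum_valK enum_rankK.
Qed.

(** The sigma type enumerates the positions on one side of the diagonal; doubling avoids a division
    in m (m - 1) / 2. *)
Lemma card_strict_triangle m :
  ((#|{: {i : 'I_m & 'I_i}}|).*2 + m = m * m)%N.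
Proof.
have <- : ((\sum_(i < m) i).*2 + m = m * m)%N.
  elim: m => [|m IHm]; first by rewrite big_ord0.
  rewrite big_ord_recr /= doubleD mulSn mulnS -IHm.
  by move: (\sum_(i < m) i)%N => t; lia.
rewrite card_tagged sumnE big_map big_enum /=; congr (_.*2 + _)%N.
by apply: eq_big => // i _; rewrite card_ord.
Qed.

(** If n < m (m + 1) / 2, the n functionals and the m (m - 1) / 2 conditions that annihilate the
    strict upper triangle number fewer than m^2, so a nonzero matrix [X] satisfies them all. *)
Lemma real_symmetric_dimension (R : realType) n m
    (a : 'I_n -> 'I_m -> 'I_m -> R) :
  (forall M : 'M[R]_m, M^T = M ->
    (forall j, \sum_i \sum_l M i l * a j i l = 0) -> M = 0) ->
  2^-1 * m%:R * (1 + m%:R) <= n%:R :> R.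
Proof.
move=> inj; suff h : (m * m.+1 <= n.*2)%N.
  have : (m * m.+1)%:R <= n.*2%:R :> R by rewrite ler_nat.
  by rewrite natrM -muln2 natrM -natr1; lra.
rewrite leqNgt; apply/negP => nm.
pose T := {i : 'I_m & 'I_i}.
have Tm := card_strict_triangle m.
pose w (t : T) : 'I_m := widen_ord (ltnW (ltn_ord (tag t))) (tagged t).
(* The first kind of equation is functional j on X + X^T, the second the vanishing of a strictly
   upper entry of X. *)
pose b (j : 'I_n + T) (p : 'I_m * 'I_m) : R := match j with
  | inl j => a j p.1 p.2 + a j p.2 p.1
  | inr t => (p == (w t, tag t))%:R end.
have [|c [[i0 l0] c0] cb] := exists_kernel b.
  rewrite card_sum card_prod !card_ord; move: Tm nm; rewrite -/T.
  by move: #|{: T}|; lia.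
(* The summand T of the equations makes X lower triangular, so that X is
   determined by the symmetric matrix X + X^T. *)
pose X : 'M[R]_m := \matrix_(i, l) c (i, l).
have Xup (i l : 'I_m) : (i < l)%N -> X i l = 0.
  move=> il; have := cb (inr (Tagged (fun i : 'I_m => 'I_i) (Ordinal il))).
  rewrite (bigD1 (i, l)) //= big1 => [|p pil]; last first.
    rewrite (_ : (w _, _) = (i, l)) ?(negbTE pil) ?mulr0 //.
    by congr pair; apply: val_inj.
  rewrite (_ : (w _, _) = (i, l)); last by congr pair; apply: val_inj.
  by rewrite eqxx mulr1 addr0 mxE.
have X0 : X + X^T = 0.
  apply: inj => [|j]; first by rewrite linearD /= trmxK addrC.
  pose g i l := c (i, l) * (a j i l + a j l i).
  have g0 : \sum_i \sum_l g i l = 0.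
    by rewrite (pair_bigA _ g) -[RHS](cb (inl j)); apply: eq_bigr => -[].
  rewrite -[RHS]g0 /g.
  under eq_bigr do under eq_bigr do rewrite !mxE mulrDl.
  under [RHS]eq_bigr do under eq_bigr do rewrite mulrDr.
  under eq_bigr do rewrite big_split /=.
  under [RHS]eq_bigr do rewrite big_split /=.
  by rewrite !big_split /=; congr (_ + _); rewrite exchange_big.
have XN i l : X i l + X l i = 0.
  by have := congr1 (fun M : 'M[R]_m => M i l) X0; rewrite !mxE.
(* Off the diagonal one of the two entries in [XN] is strictly upper; on it, [XN] says that twice
   the entry is 0. *)
have : X i0 l0 = 0.
  have := XN i0 l0; case: (ltngtP i0 l0) => [/Xup//|/Xup -> |/val_inj <-].
    by rewrite addr0.
  by lra.
by move/eqP; rewrite mxE (negbTE c0).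
Qed.

(** Hermitian matrices are parametrized by the m^2 entries of a real matrix, on which each
    functional is one real equation; n < m^2 equations would have a nonzero solution. *)
Lemma complex_hermitian_dimension (R : realType) n m
    (a : 'I_n -> 'I_m -> 'I_m -> R[i]) :
  (forall j i l, (a j i l)^*%C = a j l i) ->
  (forall M : 'M[R[i]]_m, (forall i l, (M i l)^*%C = M l i) ->
    (forall j, \sum_i \sum_l M i l * a j i l = 0) -> M = 0) ->
  (m ^ 2 <= n)%N.
Proof.
move=> ha inj; rewrite leqNgt; apply/negP => nm.
pose b (j : 'I_n) (p : 'I_m * 'I_m) : R :=
  complex.Re (a j p.1 p.2) - complex.Im (a j p.1 p.2).
have [|c [[i0 l0] c0] cb] := exists_kernel b.
  by rewrite card_prod !card_ord mulnn.
(* M = (X + X^T) + i (X - X^T), where X is the real matrix of the c (i, l):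
   this identifies the real matrices with the Hermitian ones, and turns the
   coefficients a of a functional into 2 b. *)
pose M : 'M[R[i]]_m := \matrix_(i, l)
  Complex (c (i, l) + c (l, i)) (c (i, l) - c (l, i)).
have M0 : M = 0.
  apply: inj => [i l|j].
    by rewrite !mxE /=; congr (_ +i* _)%C; ring.
  pose g i l := c (i, l) * b j (i, l).
  have g0 : \sum_i \sum_l g i l = 0.
    by rewrite (pair_bigA _ g) -[RHS](cb j); apply: eq_bigr => -[].
  pose F i l := M i l * a j i l.
  (* The two terms are conjugate, since [M] and [a j] are both Hermitian, so their sum is real. *)
  have FF i l : F i l + F l i = (2 * (g i l + g l i))%:C%C.
    rewrite /F /g /b !mxE /= -(ha j i l); case: (a j i l) => p q.
    by apply/eqP; rewrite eq_complex /=; apply/andP; split; apply/eqP; ring.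
  have : (\sum_i \sum_l F i l) *+ 2 = 0.
    rewrite mulr2n [X in _ + X]exchange_big -big_split /=.
    under eq_bigr do rewrite -big_split /=.
    under eq_bigr do under eq_bigr do rewrite FF.
    under eq_bigr do rewrite -rmorph_sum -mulr_sumr big_split /=.
    rewrite -rmorph_sum -mulr_sumr big_split /= [X in _ + X]exchange_big /=.
    by rewrite g0 addr0 mulr0.
  by move/eqP; rewrite mulrn_eq0 => /eqP.
have := congr1 (fun M : 'M[R[i]]_m => M i0 l0) M0.
rewrite !mxE => -[h1 h2]; case/negP: c0; apply/eqP; lra.
Qed.

(** * Schatten classes *)

Section schatten.
Context {R : realType} {k : scalar_kind}.
Local Notation K := (scalars R k).
Local Notation theta := (@scalar_conj R k).
Local Notation toK := (@scalar_of_real R k).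
Context {H : completeNormedModType K} (dot : {dot H for theta}).
Context (hilbertH : hilbert_norm dot).

Lemma linear_comb (F : nzRingType) (V W : lmodType F) (T : V -> W) I (r : seq I)
    (Q : pred I) (c : I -> F) (v : I -> V) : linear T ->
  T (\sum_(i <- r | Q i) c i *: v i) = \sum_(i <- r | Q i) c i *: T (v i).
Proof.
move=> linT; have T0 : T 0 = 0.
  by rewrite -(subrr 0) (GRing.zmod_morphism_linear linT) subrr.
apply: (big_rec2 (fun x y => T x = y)) => // i y x _ <-.
by rewrite linT.
Qed.

(** From P^2 = B^2 one gets P^2 x = l^2 x. If l > 0, then y = P x - l x satisfies P y = - l y, and
    positivity of P forces y = 0; if l = 0, then <P x, P x> = 0. *)
Lemma positive_absolute_value_eigen (P B : H -> H) (l : R) x :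
  positive_operator dot P -> absolute_value dot P B ->
  0 <= l -> B x = toK l *: x -> P x = toK l *: x.
Proof.
move=> [[[linP _] aP] P0] [[[[linB _] _] _] [P' adjP' BB]] l0 Bx.
have PZ a y : P (a *: y) = a *: P y by exact: (GRing.scalable_linear linP).
have BZ a y : B (a *: y) = a *: B y by exact: (GRing.scalable_linear linB).
have PB y z : P (y - z) = P y - P z by exact: (GRing.zmod_morphism_linear linP).
have P'E y : P' y = P y.
  apply/eqP; rewrite -subr_eq0 -(dot_eq0 dot); set z := (X in dot X).
  by rewrite dotDr dotNr -adjP' aP subrr.
have PP : P (P x) = (toK l * toK l) *: x.
  have := congr1 (@^~ x) BB; rewrite /= Bx BZ Bx scalerA => ->.
  by rewrite P'E.
have [l00|ln0] := eqVneq (toK l) 0.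
  apply/eqP; rewrite l00 scale0r -(dot_eq0 dot) -aP PP l00 mul0r scale0r.
  by rewrite dot0l.
have lp : 0 < toK l by rewrite lt0r ln0 scalar_of_real_ge0.
apply/eqP; rewrite -subr_eq0; set y := _ - _.
have Py : P y = - toK l *: y.
  by rewrite /y PB PZ PP scalerBr !scaleNr opprK addrC scalerA.
have := P0 y; rewrite Py dotZl mulNr oppr_ge0 pmulr_rle0 // => yy.
by rewrite -(dot_eq0 dot) eq_le yy dot_ge0.
Qed.

Lemma orthonormal_comb m (e : 'I_m -> H) (a b : 'I_m -> K) :
  (forall i j, dot (e i) (e j) = (i == j)%:R) ->
  dot (\sum_i a i *: e i) (\sum_i b i *: e i) = \sum_i a i * theta (b i).
Proof.
move=> oe; rewrite dot_suml; apply: eq_bigr => i _; rewrite dotZl dot_sumr.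
rewrite (bigD1 i) //= dotZr oe eqxx mulr1 big1 ?addr0 // => j ji.
by rewrite dotZr oe eq_sym (negbTE ji) mulr0.
Qed.

Lemma form_operator_orthonormal m (e : 'I_m -> H) (M : 'M[K]_m) j :
  (forall i j, dot (e i) (e j) = (i == j)%:R) ->
  form_operator dot e M (e j) = \sum_i M i j *: e i.
Proof.
move=> oe; rewrite form_operatorE; apply: eq_bigr => i _; congr (_ *: _).
rewrite (bigD1 j) //= oe eqxx mulr1 big1 ?addr0 // => l lj.
by rewrite oe eq_sym (negbTE lj) mulr0.
Qed.

(** [G] is the Hermitian matrix of [T] on the span of [e], and [g] is the image of [e] under a
    unitary that diagonalizes it. The last two clauses say that both families have the same
    orthogonal complement, so one can replace the other in an orthonormal basis. *)
Lemma finite_block_diagonalization (T : H -> H) m (e : 'I_m -> H)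
    (G : 'M[K]_m) :
  positive_operator dot T -> (forall i j, dot (e i) (e j) = (i == j)%:R) ->
  (forall i, T (e i) = \sum_j G i j *: e j) ->
  exists (g : 'I_m -> H) (mu : 'I_m -> R),
  [/\ forall i j, dot (g i) (g j) = (i == j)%:R,
      forall i, 0 <= mu i /\ T (g i) = toK (mu i) *: g i,
      forall x, (forall i, dot x (e i) = 0) -> forall i, dot x (g i) = 0
    & forall x, (forall i, dot x (g i) = 0) -> forall i, dot x (e i) = 0].
Proof.
move=> [[[linT _] aT] T0] oe TG.
have Tcomb (a : 'I_m -> K) : T (\sum_i a i *: e i) = \sum_i a i *: T (e i).
  exact: linear_comb.
have dTG i j : dot (T (e i)) (e j) = G i j.
  rewrite TG dot_suml (bigD1 j) //= dotZl oe eqxx mulr1 big1 ?addr0 // => l lj.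
  by rewrite dotZl oe (negbTE lj) mulr0.
have GH : (map_mx theta G)^T = G.
  by apply/matrixP => i j; rewrite !mxE -!dTG -dotC aT.
have [U [mu [UU UG]]] := hermitian_spectral GH.
pose g i := \sum_l U i l *: e l.
have og i j : dot (g i) (g j) = (i == j)%:R.
  rewrite orthonormal_comb //; have := congr1 (fun A : 'M[K]_m => A i j) UU.
  by rewrite !mxE => <-; apply: eq_bigr => l _; rewrite !mxE.
have Tg i : T (g i) = mu 0 i *: g i.
  rewrite /g Tcomb scaler_sumr.
  under eq_bigr do rewrite TG scaler_sumr.
  rewrite exchange_big /=; apply: eq_bigr => j _.
  under eq_bigr do rewrite scalerA.
  rewrite -scaler_suml scalerA; congr (_ *: _).
  have := congr1 (fun A : 'M[K]_m => A i j) UG; rewrite mxE => ->.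
  by rewrite mul_diag_mx mxE.
have mu0 i : 0 <= mu 0 i.
  by have := T0 (g i); rewrite Tg dotZl og eqxx mulr1.
have /choice[nu nuP] : forall i, exists a : R, 0 <= a /\ mu 0 i = toK a.
  by move=> i; have [a a0 ea] := scalar_ge0_real (mu0 i); exists a.
exists g, nu; split=> // [i|x xe i|x xg l].
- by have [nu0 <-] := nuP i.
- by rewrite /g dot_sumr big1 // => l _; rewrite dotZr xe mulr0.
(* A one-sided inverse of a square matrix is two-sided, so the columns of [U] are orthonormal as
   well and the change of basis can be inverted. *)
have -> : e l = \sum_i theta (U i l) *: g i.
  have UU' := mulmx1C UU; rewrite /g.
  under eq_bigr do rewrite scaler_sumr.
  rewrite exchange_big /= (bigD1 l) //= [X in _ + X]big1 ?addr0 => [|j jl].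
    under eq_bigr do rewrite scalerA.
    rewrite -scaler_suml; have := congr1 (fun A : 'M[K]_m => A l l) UU'.
    rewrite !mxE eqxx => h; rewrite -[LHS]scale1r -[X in X *: _]h.
    by congr (_ *: _); apply: eq_bigr => i _; rewrite !mxE.
  under eq_bigr do rewrite scalerA.
  rewrite -scaler_suml; have := congr1 (fun A : 'M[K]_m => A l j) UU'.
  rewrite !mxE eq_sym (negbTE jl) => h.
  rewrite -[RHS](scale0r (e j)) -[X in _ = X *: _]h.
  by congr (_ *: _); apply: eq_bigr => i _; rewrite !mxE.
by rewrite dot_sumr big1 // => i _; rewrite dotZr xg mulr0.
Qed.

(** Being positive, [T] is its own absolute value, so it suffices to find an eigenbasis of [T] and a
    power along it that has a trace. Only the block selected by [sigma] has to be changed, as the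
    perturbation vanishes on the other basis vectors. *)
Lemma schatten_form_operator (q : R) (P C : H -> H) (t : K) D (e : nat -> H)
    (lambda : nat -> R) m (sigma : 'I_m -> nat) (M : 'M[K]_m) :
  compact_operator P -> bounded_operator C -> has_trace dot C t ->
  orthonormal_basis dot D e ->
  (forall i, D i -> [/\ 0 <= lambda i, P (e i) = toK (lambda i) *: e i
                      & C (e i) = toK (lambda i `^ q) *: e i]) ->
  injective sigma -> (forall i, D (sigma i)) ->
  let T x := P x + form_operator dot (e \o sigma) M x in
  positive_operator dot T -> schatten toK dot q%:E T.
Proof.
move=> cP bC trC De eigP sinj Ds T posT.
split; first by apply: compact_operatorD => //; exact: compact_finite_rank.
have oe (i j : 'I_m) : dot ((e \o sigma) i) ((e \o sigma) j) = (i == j)%:R.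
  by rewrite De.1 //= (inj_eq sinj).
pose G : 'M[K]_m := \matrix_(i, j)
  (toK (lambda (sigma i)) * (i == j)%:R + M j i).
have TG i : T ((e \o sigma) i) = \sum_j G i j *: (e \o sigma) j.
  rewrite /T form_operator_orthonormal //=; have [_ -> _] := eigP _ (Ds i).
  under [RHS]eq_bigr do rewrite mxE scalerDl.
  rewrite big_split /=; congr (_ + _).
  rewrite (bigD1 i) //= eqxx mulr1 big1 ?addr0 // => j ji.
  by rewrite eq_sym (negbTE ji) mulr0 scale0r.
have [g [mu [og Tg eg ge]]] := finite_block_diagonalization posT oe TG.
(* The index set [D] is kept: [g i] takes the position [sigma i] and all other vectors stay. *)
pose e' j := if [pick i | sigma i == j] is Some i then g i else e j.
pose lambda' j := if [pick i | sigma i == j] is Some i then mu i else lambda j.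
have e'P j : (exists i, [/\ sigma i = j, e' j = g i & lambda' j = mu i]) \/
    [/\ forall i, sigma i != j, e' j = e j & lambda' j = lambda j].
  rewrite /e' /lambda'; case: pickP => [i /eqP sij|sj]; [left|right].
    by exists i.
  by split=> // i; rewrite sj.
have e's i : e' (sigma i) = g i.
  by have [[j [/sinj -> ->]]|[/(_ i)]] := e'P (sigma i); rewrite ?eqxx.
have ge_ij i j : D j -> (forall l, sigma l != j) -> dot (e j) (g i) = 0.
  move=> Dj sj; apply: (eg (e j)) => l /=.
  by rewrite De.1 // eq_sym (negbTE (sj l)).
(* The difference y of the two sides is orthogonal to the old block, hence to [g i] by [eg], so <y,
   y> = 0. *)
have gcomb i : g i = \sum_l dot (g i) (e (sigma l)) *: e (sigma l).
  apply/eqP; rewrite -subr_eq0 -(dot_eq0 dot); set y := (X in dot X).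
  have ye l : dot y (e (sigma l)) = 0.
    rewrite dotDl dotNl dot_suml (bigD1 l) //= dotZl oe eqxx mulr1 big1.
      by rewrite addr0 subrr.
    by move=> l' ll'; rewrite dotZl oe (negbTE ll') mulr0.
  have -> : dot y y = dot y (g i - \sum_l dot (g i) (e (sigma l)) *: e (sigma l)).
    by [].
  rewrite dotDr dotNr (eg y ye) dot_sumr big1 ?subrr // => l _.
  by rewrite dotZr ye mulr0.
have De' : orthonormal_basis dot D e'.
  split=> [i j Di Dj|x xe'].
    have [[a [sa -> _]]|[si -> _]] := e'P i.
      have [[b [sb -> _]]|[sj -> _]] := e'P j.
        by rewrite og -sa -sb (inj_eq sinj).
      by rewrite dotC ge_ij // rmorph0 -sa (negbTE (sj a)).
    have [[b [sb -> _]]|[sj -> _]] := e'P j.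
      by rewrite ge_ij // -sb eq_sym (negbTE (si b)).
    exact: De.1.
  have xe : forall i, dot x ((e \o sigma) i) = 0.
    by apply: ge => i; rewrite -e's xe'.
  apply: De.2 => j Dj; have [[i [<- _ _]]|[_ ej _]] := e'P j; first exact: xe.
  by rewrite -ej xe'.
pose a1 i := - toK (lambda (sigma i) `^ q) *: e (sigma i).
pose a2 i := toK (mu i `^ q) *: g i.
(* The power of T is C with its values on the old block removed and the powers
   of the new eigenvalues put in. *)
exists T, (fun x =>
  (C x + finite_rank dot (e \o sigma) a1 x) + finite_rank dot g a2 x).
exists ((t + \sum_i dot (a1 i) ((e \o sigma) i)) + \sum_i dot (a2 i) (g i)).
split.
- by split=> //; exists T => //; exact: posT.1.2.
- split.
    do 2 (apply: bounded_operatorD;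
      last exact: (compact_finite_rank hilbertH _ _).1).
    exact: bC.
  exists D, e', lambda'; split=> // j Dj.
  have [[i [sij -> ->]]|[sj -> ->]] := e'P j.
    have [mui Tgi] := Tg i; split=> //.
    rewrite [X in _ + X](_ : _ = a2 i); last first.
      rewrite /finite_rank (bigD1 i) //= og eqxx scale1r big1 ?addr0 // => l li.
      by rewrite og eq_sym (negbTE li) scale0r.
    (* [C] and the [a1] term cancel on each vector of the old block, hence on [g i], which is a
       combination of these. *)
    rewrite [X in X + _](_ : _ = 0) ?add0r // {1}[g i]gcomb.
    rewrite (linear_comb _ _ _ _ bC.1).
    rewrite -big_split big1 // => l _ /=; have [_ _ ->] := eigP _ (Ds l).
    by rewrite /a1 scaleNr scalerN subrr.
  have [lj Pj Cj] := eigP j Dj.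
  have ej0 l : dot (e j) (e (sigma l)) = 0.
    by rewrite De.1 // eq_sym (negbTE (sj l)).
  split=> //.
    rewrite /T Pj form_operatorE big1 ?addr0 // => l _.
    by rewrite big1 ?scale0r // => l' _; rewrite ej0 mulr0.
  rewrite Cj /finite_rank !big1 ?addr0 // => l _.
    by rewrite ge_ij // scale0r.
  by rewrite /= ej0 scale0r.
- do 2 (apply: has_traceD; last exact: has_trace_finite_rank).
  exact: trC.
Qed.

End schatten.

(** * Rank *)

Definition dimension_bound (R : realType) (k : scalar_kind) (n r : nat)
  : Prop :=
  match k with
  | RealScalars => 2^-1 * r%:R * (1 + r%:R) <= n%:R :> R
  | ComplexScalars => (r ^ 2 <= n)%N
  end.

(** A crude bound common to both kinds of scalars; it guarantees that a family of maximal size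
    exists. *)
Lemma dimension_bound_leq (R : realType) (k : scalar_kind) n r :
  dimension_bound R k n r -> (r <= n.*2)%N.
Proof.
case: k => /= rn; last by nia.
have : (r * r.+1)%:R <= n.*2%:R :> R.
  by rewrite natrM -muln2 natrM -natr1; lra.
by rewrite ler_nat; nia.
Qed.

Lemma hermitian_dimension_bound (R : realType) (k : scalar_kind) n m
    (a : 'I_n -> 'I_m -> 'I_m -> scalars R k) :
  (forall j i l, scalar_conj (a j i l) = a j l i) ->
  (forall M : 'M[scalars R k]_m, selfadjoint_mx M ->
    (forall j, \sum_i \sum_l M i l * a j i l = 0) -> M = 0) ->
  dimension_bound R k n m.
Proof.
case: k a => /= a ha inj; last exact: complex_hermitian_dimension ha inj.
apply: (@real_symmetric_dimension R n m a) => M symM; apply: inj => i j.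
by rewrite -[in RHS]symM mxE.
Qed.

Lemma exists_max (E : nat -> Prop) b : E 0%N -> (forall m, E m -> (m <= b)%N) ->
  exists2 m, E m & ~ E m.+1.
Proof.
move=> E0 Eb; have exE : exists m, `[< E m >] by exists 0%N; apply/asboolP.
have ubE m : `[< E m >] -> (m <= b)%N by move=> /asboolP; exact: Eb.
exists (ex_maxn exE ubE); case: ex_maxnP => m /asboolP // Em maxm.
by move=> /asboolP /maxm; rewrite ltnn.
Qed.

(** If some [P x] were outside the span of the [P (u i)], appending x would give an independent
    family of size m + 1. *)
Lemma has_rank_of_maximal (K : numFieldType) (V : lmodType K) (P : V -> V) m :
  let E m := exists u : 'I_m -> V, forall c : 'I_m -> K,
    \sum_i c i *: P (u i) = 0 -> forall i, c i = 0 in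
  E m -> ~ E m.+1 -> has_rank P m.
Proof.
move=> E [u freeu] nE; exists (P \o u); split=> // x.
apply: contrapT => nspan; apply: nE.
exists (fun i : 'I_m.+1 => if insub (val i) is Some j then u j else x) => c.
rewrite big_ord_recr /= insubN ?ltnn //.
under eq_bigr do rewrite valK.
have [c0|c0] := eqVneq (c ord_max) 0.
  rewrite c0 scale0r addr0 => /freeu cw i.
  have [im|mi] := ltnP i m; last first.
    rewrite -c0; congr c; apply: val_inj => /=; apply/eqP.
    by rewrite eqn_leq mi -ltnS ltn_ord.
  by rewrite -(cw (Ordinal im)); congr c; apply: val_inj.
move=> /eqP; rewrite addrC addr_eq0 => /eqP Px; exfalso; apply: nspan.
exists (fun i => - (c ord_max)^-1 * c (widen_ord (leqnSn m) i)).
under eq_bigr do rewrite -scalerA.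
by rewrite -scaler_sumr scaleNr -scalerN -Px scalerA mulVf // scale1r.
Qed.

Section rank.
Context {R : realType} {k : scalar_kind}.
Local Notation K := (scalars R k).
Local Notation theta := (@scalar_conj R k).
Local Notation toK := (@scalar_of_real R k).
Context {H : completeNormedModType K} (dot : {dot H for theta}).

(** By maximality every basis vector e j outside the family has eigenvalue 0, so the coordinate <P
    x, e j> = <x, P (e j)> vanishes there and [P x] lies in the span of the family. *)
Lemma has_rank_eigenbasis (P : H -> H) D (e : nat -> H) (mu : nat -> K) m :
  self_adjoint dot P -> orthonormal_basis dot D e ->
  (forall i, D i -> P (e i) = mu i *: e i) ->
  let E m := exists sigma : 'I_m -> nat, [/\ injective sigma,
    forall i, D (sigma i) & forall i, mu (sigma i) != 0] in
  E m -> ~ E m.+1 -> has_rank P m.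
Proof.
move=> [[linP _] aP] De eP E [sigma [sinj Ds mus]] nE.
have PZ a y : P (a *: y) = a *: P y by exact: (GRing.scalable_linear linP).
have oe (i j : 'I_m) : dot (e (sigma i)) (e (sigma j)) = (i == j)%:R.
  by rewrite De.1 //= (inj_eq sinj).
have dot_comb (c : 'I_m -> K) j :
    dot (\sum_i c i *: e (sigma i)) (e (sigma j)) = c j.
  rewrite dot_suml (bigD1 j) //= dotZl oe eqxx mulr1 big1 ?addr0 // => l lj.
  by rewrite dotZl oe (negbTE lj) mulr0.
exists (e \o sigma); split=> [i|c c0 i|x].
- exists ((mu (sigma i))^-1 *: e (sigma i)) => //.
  by rewrite PZ eP // scalerA mulVf // scale1r.
- by rewrite -(dot_comb c i) c0 dot0l.
exists (fun i => dot (P x) (e (sigma i))).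
apply/eqP; rewrite -subr_eq0; apply/eqP/De.2 => j Dj.
rewrite dotDl dotNl.
have [[i <-]|nsj] := pselect (exists i, sigma i = j).
  by rewrite dot_comb subrr.
have {}nsj i : sigma i != j by apply/eqP => sij; apply: nsj; exists i.
have [muj|muj] := eqVneq (mu j) 0.
  rewrite aP eP // muj scale0r dot0r dot_suml big1 ?subrr // => i _.
  by rewrite dotZl De.1 // (negbTE (nsj i)) mulr0.
exfalso; apply: nE.
exists (fun i : 'I_m.+1 => if insub (val i) is Some l then sigma l else j).
split=> [i1 i2|i|i]; last 2 first.
- by case: insubP.
- by case: insubP.
case: insubP => [l1 _ h1|]; case: insubP => [l2 _ h2|].
- by move=> /sinj l12; apply: val_inj; rewrite -h1 -h2 l12.
- by move=> _ /eqP; rewrite (negbTE (nsj l1)).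
- by move=> _ /esym /eqP; rewrite (negbTE (nsj l2)).
- rewrite -!leqNgt => m2 m1 _; apply: val_inj; apply/eqP.
  have := ltn_ord i1; have := ltn_ord i2; rewrite !ltnS => i2m i1m.
  by rewrite eqn_leq (leq_trans i1m) // (leq_trans i2m).
Qed.

End rank.

Theorem corollary3p8 (R : realType) (k : scalar_kind)
    (H : completeNormedModType (scalars R k))
    (dot : {dot H for @scalar_conj R k})
    (p : R) (q : \bar R) (n : nat)
    (A : 'I_n -> H -> H) (beta : 'I_n -> scalars R k) (P : H -> H)
    (hilbertH : hilbert_norm dot)
    (sepH : separable H)
    (p_ge1 : 1 <= p)
    (pq_conj : (p%:E^-1 + q^-1 = 1)%E)
    (n_ge1 : (1 <= n)%N)
    (A_schatten : forall j, schatten (@scalar_of_real R k) dot p%:E (A j))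
    (A_sa : forall j, self_adjoint dot (A j))
    (P_extreme : extreme_point
      [set Q | positive_schatten (@scalar_of_real R k) dot q Q /\
               forall j, has_trace dot (Q \o A j) (beta j)] P) :
  exists2 r : nat, has_rank P r &
    match k with
    | RealScalars => 2^-1 * r%:R * (1 + r%:R) <= n%:R :> R
    | ComplexScalars => (r ^ 2 <= n)%N
    end.
Proof.
rewrite -/(dimension_bound R k n _).
have bound m (u : 'I_m -> H) :
    (forall c : 'I_m -> scalars R k,
      \sum_i c i *: P (u i) = 0 -> forall i, c i = 0) ->
    (forall M, selfadjoint_mx M ->
      positive_operator dot (fun x => P x + form_operator dot (P \o u) M x) ->
      schatten (@scalar_of_real R k) dot q
        (fun x => P x + form_operator dot (P \o u) M x)) ->
    dimension_bound R k n m.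
  move=> freeu schu.
  apply: (@hermitian_dimension_bound R k n m
    (fun j i l => dot (P (u i)) (A j (P (u l))))) => [j i l|].
    by rewrite -dotC (A_sa j).2.
  exact: (extreme_point_trace_injective hilbertH A_sa P_extreme freeu schu).
have [[[posP [cP schP]] _] _] := P_extreme.
clear A_schatten pq_conj P_extreme.
(* At q = -oo [schatten] is False; the case q = +oo, where only compactness has to be preserved,
   comes first. *)
case: q schP bound => [q| |] // schP bound; last first.
  pose E m := exists u : 'I_m -> H, forall c : 'I_m -> scalars R k,
    \sum_i c i *: P (u i) = 0 -> forall i, c i = 0.
  have Eb m : E m -> dimension_bound R k n m.
    move=> [u freeu]; apply: (bound m u) => // M _ _; split=> //.
    by apply: compact_operatorD => //; exact: compact_finite_rank.
  have [||m Em nEm] := @exists_max E n.*2.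
  - by exists (fun=> 0) => c _ [].
  - by move=> m /Eb /dimension_bound_leq.
  - by exists m; [exact: has_rank_of_maximal Em nEm|exact: Eb].
have [B [C [t [absB [bC [D [e [lambda [De eigB]]]]] trC]]]] := schP.
have eigP i : D i -> [/\ 0 <= lambda i,
    P (e i) = scalar_of_real k (lambda i) *: e i
  & C (e i) = scalar_of_real k (lambda i `^ q) *: e i].
  move=> /eigB[l0 Be Ce]; split=> //.
  exact: (positive_absolute_value_eigen posP absB l0 Be).
pose mu i := scalar_of_real k (lambda i).
pose E m := exists sigma : 'I_m -> nat, [/\ injective sigma,
    forall i, D (sigma i) & forall i, mu (sigma i) != 0].
have Eb m : E m -> dimension_bound R k n m.
  move=> [sigma [sinj Ds mus]].
  (* The scaling makes [P (u i)] equal to the basis vector itself. *)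
  pose u i := (mu (sigma i))^-1 *: e (sigma i).
  have Pu : P \o u = e \o sigma.
    apply/funext => i; rewrite /= /u (GRing.scalable_linear posP.1.1.1) /=.
    by have [_ -> _] := eigP _ (Ds i); rewrite scalerA mulVf // scale1r.
  apply: (bound m u) => [c|M hM]; last first.
    rewrite Pu.
    exact: (schatten_form_operator hilbertH cP bC trC De eigP sinj Ds).
  under eq_bigr do rewrite -[P (u _)]/((P \o u) _) Pu.
  move=> c0 i; have := congr1 (dot^~ (e (sigma i))) c0.
  rewrite dot0l dot_suml (bigD1 i) //= dotZl De.1 // eqxx mulr1 big1 ?addr0 //.
  by move=> l li; rewrite dotZl De.1 // (inj_eq sinj) (negbTE li) mulr0.
have [||m Em nEm] := @exists_max E n.*2.
- by exists (fun=> 0%N); split=> [[]|[]|[]].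
- by move=> m /Eb /dimension_bound_leq.
exists m; last exact: Eb.
apply: (has_rank_eigenbasis posP.1 De _ Em nEm) => i Di.
by have [_ -> _] := eigP i Di.
Qed.
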